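(* Let $G$ be a countable discrete group which is amenable and ICC. Then every frame representation of $G$ has almost invariant vectors.
   Context: ''Countable'' means countably infinite. Hilbert spaces are complex, separable and (here) nonzero; $\mathcal U(H)$ is the group of unitary operators on $H$. Amenability: $G$ is amenable if there is a left-invariant state on $\ell^\infty(G)$, i.e. a positive linear functional $\varphi:\ell^\infty(G)\to\mathbb C$ taking the value $1$ on the constant function $1$ and invariant under left translation by elements of $G$. $G$ is ICC (infinite conjugacy classes) if for every $g\in G$ with $g\ne e$ the conjugacy class $\{xgx^{-1}:x\in G\}$ is infinite. A unitary representation $\pi:G\to\mathcal U(H)$ is a frame representation if there is a vector $\varphi\in H$ such that $\{\pi_g\varphi\}_{g\in G}$ is a frame for $H$, i.e. there are $A,B>0$ with $A\|v\|^2\le\sum_{g\in G}|\langle v,\pi_g\varphi\rangle|^2\le B\|v\|^2$ for all $v\in H$. $\pi$ has almost invariant vectors if there is a net $(v_i)_{i\in I}$ of unit vectors in $H$ with $\|\pi_g v_i-v_i\|\to0$ for every $g\in G$. *)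

(* Defs.v *)
From HB Require Import structures.
From mathcomp Require Import all_boot all_order all_algebra.
From mathcomp Require Import sesquilinear complex.
From mathcomp Require Import all_classical all_reals all_analysis.

Set Implicit Arguments.
Unset Strict Implicit.
Unset Printing Implicit Defensive.

Import Order.TTheory GRing.Theory Num.Theory numFieldNormedType.Exports.

Local Open Scope classical_set_scope.
Local Open Scope ring_scope.
Local Open Scope complex_scope.

(* The library norm on a space over R[i] takes its values in R[i] (with zero
   imaginary part); [rnorm] is the same number seen in R. *)
Definition rnorm (R : rcfType) (V : normedZmodType R[i]) (v : V) : R :=
  complex.Re `|v|.

(* The inner product is linear in the first variable, conjugate-linear in the
   second. *)
Record hilbertSpace (R : realType) := HilbertSpace {
  hilbert_sort :> completeNormedModType R[i] ;
  inner : {dot hilbert_sort for @Num.conj R[i]} ;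
  inner_norm : forall v : hilbert_sort, inner v v = `|v| ^+ 2
}.

Definition separable (T : topologicalType) : Prop :=
  exists2 D : set T, countable D & dense D.

Definition unitary (R : realType) (H : hilbertSpace R) (U : {linear H -> H}) :=
  bijective U /\ forall u v : H, inner H (U u) (U v) = inner H u v.

Record unitary_rep (G : groupType) (R : realType) (H : hilbertSpace R) :=
  UnitaryRep {
    rep_fun :> G -> {linear H -> H} ;
    rep_unitary : forall g, unitary (rep_fun g) ;
    repM : forall (g h : G) (v : H), rep_fun (g * h)%g v = rep_fun g (rep_fun h v)
  }.

Definition icc (G : groupType) : Prop :=
  forall g : G, g != 1%g -> infinite_set [set (x * g * x^-1)%g | x in [set: G]].

Section Linfty.
Variables (G : Type) (R : realType).

Definition bounded_pred : {pred (G -> R[i])} :=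
  [pred f : G -> R[i] | `[< exists M : R, forall x, `|f x| <= M%:C >]].

Lemma bounded_pred_submod : submod_closed bounded_pred.
Proof.
split; first by apply/asboolP; exists 0 => x; rewrite normr0.
move=> a f g /asboolP[M fM] /asboolP[N gN]; apply/asboolP.
exists (rnorm a * M + N) => x.
rewrite rmorphD rmorphM /= (le_trans (ler_normD _ _))// lerD// normrM.
by rewrite ler_pM.
Qed.

HB.instance Definition _ :=
  GRing.isSubmodClosed.Build R[i] (G -> R[i]) bounded_pred bounded_pred_submod.

Record linf := Linf { linf_val :> G -> R[i] ; _ : linf_val \in bounded_pred }.

HB.instance Definition _ := [isSub for linf_val].
HB.instance Definition _ := [Choice of linf by <:].
HB.instance Definition _ := [SubChoice_isSubLmodule of linf by <:].

Lemma linf_comp_subproof (s : G -> G) (f : linf) : f \o s \in bounded_pred.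
Proof.
have /asboolP[M fM] := valP f.
by apply/asboolP; exists M => x; apply: fM.
Qed.

Definition linf_comp (s : G -> G) (f : linf) : linf :=
  Linf (linf_comp_subproof s f).

Lemma linf_cst_subproof (c : R[i]) : (fun=> c) \in bounded_pred.
Proof. by apply/asboolP; exists (rnorm c). Qed.

Definition linf_cst (c : R[i]) : linf := Linf (linf_cst_subproof c).

Definition is_state (phi : {scalar linf}) : Prop :=
  (forall f : linf, (forall x, 0 <= f x) -> 0 <= phi f) /\ phi (linf_cst 1) = 1.

End Linfty.

Definition ltranslate (G : groupType) (R : realType) (g : G) (f : linf G R) :
  linf G R := linf_comp (fun x => (g^-1 * x)%g) f.

Definition amenable (G : groupType) (R : realType) : Prop :=
  exists phi : {scalar linf G R},
    is_state phi /\ forall g f, phi (ltranslate g f) = phi f.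

Definition is_frame (I : choiceType) (R : realType) (H : hilbertSpace R)
    (e : I -> H) : Prop :=
  exists A B : R, [/\ 0 < A, 0 < B & forall v : H,
    ((A * rnorm v ^+ 2)%:E <=
       \esum_(i in [set: I]) (rnorm (inner H v (e i)) ^+ 2)%:E)%E /\
    (\esum_(i in [set: I]) (rnorm (inner H v (e i)) ^+ 2)%:E <=
       (B * rnorm v ^+ 2)%:E)%E].

Definition frame_rep (G : groupType) (R : realType) (H : hilbertSpace R)
    (pi : unitary_rep G H) : Prop :=
  exists phi : H, is_frame (fun g : G => pi g phi).

Definition directed (I : Type) (le : I -> I -> Prop) : Prop :=
  [/\ inhabited I, forall i, le i i,
      forall i j k, le i j -> le j k -> le i k &
      forall i j, exists k, le i k /\ le j k].

Definition tails (I : Type) (le : I -> I -> Prop) : set_system I :=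
  [set A | exists i, forall j, le i j -> A j].

Definition almost_invariant_vectors (G : groupType) (R : realType)
    (H : hilbertSpace R) (pi : unitary_rep G H) : Prop :=
  exists (I : Type) (le : I -> I -> Prop) (v : I -> H),
    [/\ directed le, forall i, rnorm (v i) = 1 &
        forall g : G, rnorm (pi g (v i) - v i) @[i --> tails le] --> (0 : R)].

(* Main.v *)
Require Import Defs.
From HB Require Import structures.
From mathcomp Require Import all_boot all_order all_algebra.
From mathcomp Require Import sesquilinear complex.
From mathcomp Require Import finmap ring lra.
From mathcomp Require Import all_classical all_reals all_analysis.

(** Let phi generate the frame and put psi g = <phi, pi_g phi>.  The upper frame
    bound applied to phi says that psi is square summable, and the lower frame
    bound together with the existence of a nonzero vector gives phi != 0.

    Amenability provides, for a finite set S and e > 0, a finitely supported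
    function c on G which is almost invariant in l2 under left translation by S
    ([amenable_l2_almost_invariant]).  For x in G transport c to the vector
    w_x = sum_h c(h) pi_(hx) phi of H.  Left translating c amounts to applying
    pi to w_x, and
      |w_x|^2 = sum_(h, k) c(h) c(k) psi (x^-1 (h^-1 k) x).
    The diagonal terms add up to |phi|^2 |c|^2.  The off-diagonal ones involve
    psi at the conjugates by x of finitely many elements h^-1 k != 1, and x can
    be chosen so that all these conjugates avoid the finite set where psi is not
    small: the x sending a given g != 1 to a given k form a set of measure zero
    for the invariant mean, because its translates indexed by the infinite
    conjugacy class of g are disjoint ([icc_conjugate_escape]).  For such an x
    the map c |-> w_x is, up to the factor |phi| and a small error, isometric on
    functions supported in a given finite set ([translate_norm_sqr]), so w_x is
    as invariant as c is ([bessel_orbit_almost_invariant]).  This replaces the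
    usual argument, in which pi is a subrepresentation of the regular
    representation and the group von Neumann algebra is a factor.

    The passage from an invariant mean to c is the Day-Reiter argument.  If no
    finitely supported probability f on G were almost invariant in l1, the
    Hahn-Banach theorem, in the form of the Mazur-Orlicz theorem
    ([mazur_orlicz]), would give bounded functions F_s with
    sum_s (F_s (s g) - F_s g) >= e for all g, and the mean of the left-hand side
    is 0.  The square root of an l1-almost invariant f is l2-almost invariant. *)

Set Implicit Arguments.
Unset Strict Implicit.
Unset Printing Implicit Defensive.
Import Order.TTheory GRing.Theory Num.Theory.
Local Open Scope classical_set_scope.
Local Open Scope card_scope.
Local Open Scope ring_scope.

(** * Sublinear functionals and the Mazur-Orlicz theorem *)

Section MazurOrlicz.
Variables (R : realType) (E : lmodType R).
Implicit Types p q : E -> R.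

(** Only the inequality is asked for in the homogeneity; applied to a and to a^-1
    it gives equality for a > 0. *)
Definition sublinear p : Prop :=
  (forall x y, p (x + y) <= p x + p y) /\
  (forall (a : R) x, 0 <= a -> p (a *: x) <= a * p x).

Lemma sublinear0 p : sublinear p -> p 0 = 0.
Proof.
move=> [pD pZ]; apply/eqP; rewrite eq_le; apply/andP; split.
  by have := pZ 0 0 (lexx _); rewrite scale0r mul0r.
by have := pD 0 0; rewrite addr0 lerDl.
Qed.

Lemma sublinear_oppr p x : sublinear p -> - p (- x) <= p x.
Proof.
move=> sp; have [pD _] := sp.
by have := pD x (- x); rewrite subrr (sublinear0 sp); lra.
Qed.

(** For K a convex cone of pairs (c, t) such that t <= p c, this is the largest
    sublinear functional below p whose value at - c is at most - t for all (c, t) in K.  A linear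
    functional below it thus satisfies t <= L c on K. *)
Definition cone_lower p (K : E -> R -> Prop) x : R :=
  inf [set r | exists c t, K c t /\ r = p (x + c) - t].

Section ConeLower.
Variables (p : E -> R) (K : E -> R -> Prop).
Hypothesis sp : sublinear p.
Hypothesis K0 : K 0 0.
Hypothesis KD : forall c t d s, K c t -> K d s -> K (c + d) (t + s).
Hypothesis KZ : forall (a : R) c t, 0 <= a -> K c t -> K (a *: c) (a * t).
Hypothesis Kp : forall c t, K c t -> t <= p c.

Lemma cone_lower_le c t x : K c t -> cone_lower p K x <= p (x + c) - t.
Proof.
move=> Kct; apply: ge_inf; last by exists c, t.
exists (- p (- x)) => _ [d [s [Kds ->]]].
rewrite lerBrDr -lerBrDl opprK addrC.
apply: (le_trans (Kp Kds)); have [pD _] := sp.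
by have := pD (x + d) (- x); rewrite addrAC subrr add0r addrC.
Qed.

Lemma cone_lower_ge x r :
  (forall c t, K c t -> r <= p (x + c) - t) -> r <= cone_lower p K x.
Proof.
move=> rP; apply: lb_le_inf; first by exists (p (x + 0) - 0), 0, 0.
by move=> _ [c [t [Kct ->]]]; apply: rP.
Qed.

Lemma cone_lower_sublinear : sublinear (cone_lower p K).
Proof.
have [pD pZ] := sp; split=> [x y|a x a0].
  rewrite -lerBlDl; apply: cone_lower_ge => c t Kct.
  rewrite lerBlDr -lerBlDl; apply: cone_lower_ge => d s Kds.
  rewrite lerBlDl; have := cone_lower_le (x + y) (KD Kct Kds).
  move=> /le_trans; apply; rewrite [x + y]addrC addrACA.
  by have := pD (y + c) (x + d); lra.
have [->|an0] := eqVneq a 0.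
  rewrite scale0r mul0r; have := cone_lower_le 0 K0.
  by rewrite addr0 subr0 (sublinear0 sp).
have a_gt0 : 0 < a by rewrite lt_def an0.
rewrite -ler_pdivrMl//; apply: cone_lower_ge => c t Kct.
rewrite ler_pdivrMl// mulrBr.
have := cone_lower_le (a *: x) (KZ a0 Kct); move=> /le_trans; apply.
by rewrite lerB// -scalerDr pZ.
Qed.

End ConeLower.

(** Lowering q along the ray of pairs (a y, a q(y)) yields a sublinear functional
    whose value at - y is at most - q y.  By minimality q (- y) = - q y, and a
    sublinear odd functional is linear. *)
Lemma minimal_sublinear_linear q : sublinear q ->
  (forall q', sublinear q' -> (forall x, q' x <= q x) -> forall x, q x <= q' x) ->
  exists L : {scalar E}, L =1 q.
Proof.
move=> sq qmin; have [qD qZ] := sq.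
have qN y : q (- y) = - q y.
  pose K c t := exists a, [/\ 0 <= a, c = a *: y & t = a * q y].
  have K0 : K 0 0 by exists 0; rewrite scale0r mul0r.
  have KD c t d s : K c t -> K d s -> K (c + d) (t + s).
    move=> [a [a0 -> ->]] [b [b0 -> ->]]; exists (a + b).
    by rewrite scalerDl mulrDl addr_ge0.
  have KZ a c t : 0 <= a -> K c t -> K (a *: c) (a * t).
    move=> a0 [b [b0 -> ->]]; exists (a * b).
    by rewrite scalerA mulrA mulr_ge0.
  have Kp c t : K c t -> t <= q c.
    move=> [a [a0 -> ->]]; have [->|an0] := eqVneq a 0.
      by rewrite mul0r scale0r sublinear0.
    have a_gt0 : 0 < a by rewrite lt_def an0.
    rewrite mulrC -ler_pdivlMr// mulrC.
    have := qZ a^-1 (a *: y); rewrite scalerA mulVf// scale1r; apply.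
    by rewrite invr_ge0.
  have Kqy : K y (q y) by exists 1; rewrite scale1r mul1r.
  apply/eqP; rewrite eq_le -lerN2 opprK; apply/andP; split; last first.
    by have := sublinear_oppr (- y) sq; rewrite opprK lerNl.
  have sK := cone_lower_sublinear sq K0 KD KZ Kp.
  have Kle x : cone_lower q K x <= q x.
    by have := cone_lower_le sq Kp x K0; rewrite addr0 subr0.
  have := qmin _ sK Kle (- y).
  have := cone_lower_le sq Kp (- y) Kqy; rewrite addNr (sublinear0 sq).
  by lra.
have qDE x y : q (x + y) = q x + q y.
  apply/eqP; rewrite eq_le qD/=.
  by have := qD (- x) (- y); rewrite -opprD !qN; lra.
have qZ0 a x : 0 <= a -> q (a *: x) = a * q x.
  move=> a0; apply/eqP; rewrite eq_le qZ//=.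
  by have := qZ a (- x) a0; rewrite scalerN !qN; lra.
have qZE a x : q (a *: x) = a * q x.
  have [a0|a0] := leP 0 a; first exact: qZ0.
  rewrite -[in LHS](opprK a) scaleNr qN qZ0 ?oppr_ge0 ?(ltW a0)//.
  by rewrite mulNr opprK.
have qlin : scalar q by move=> a x y; rewrite qDE qZE.
by exists (HB.pack_for {scalar E} q (GRing.isLinear.Build R E R *%R q qlin)).
Qed.

(** Zorn's lemma gives a minimal sublinear functional below p: the infimum of a
    chain of sublinear functionals below p is finite, since x |-> - p (- x) is a
    lower bound, and sublinear, since two members of the chain can be replaced
    by the smaller one. *)
Lemma hahn_banach p : sublinear p -> exists L : {scalar E}, forall x, L x <= p x.
Proof.
move=> sp; pose S := {q : E -> R | sublinear q /\ forall x, q x <= p x}.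
pose ge_fun (q q' : S) := `[< forall x, sval q' x <= sval q x >].
have sN (q : S) x : - p (- x) <= sval q x.
  case: q => q [sq qp] /=; apply: le_trans (sublinear_oppr _ sq).
  by rewrite lerN2.
pose p0 : S := exist _ p (conj sp (fun x => lexx (p x))).
have [||A Atot|q qmax] := @ZL_preorder S p0 ge_fun.
- by move=> q; apply/asboolP.
- move=> q r s /asboolP qr /asboolP rs; apply/asboolP => x.
  exact: le_trans (rs x) (qr x).
- have [A0|/set0P[q0 Aq0]] := eqVneq A set0.
    by exists p0 => s; rewrite A0.
  pose m x := inf [set sval q x | q in A].
  have mle (q : S) x : A q -> m x <= sval q x.
    move=> Aq; apply: ge_inf; last by exists q.
    by exists (- p (- x)) => _ [r _ <-].
  have mge r x : (forall q : S, A q -> r <= sval q x) -> r <= m x.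
    move=> rP; apply: lb_le_inf; first by exists (sval q0 x), q0.
    by move=> _ [q Aq <-]; exact: rP.
  have sm : sublinear m.
    split=> [x y|a x a0].
      rewrite -lerBlDl; apply: (mge) => q Aq; rewrite lerBlDr -lerBlDl.
      apply: (mge) => r Ar; rewrite lerBlDl.
      have [/asboolP qr|/asboolP rq] := Atot _ _ Aq Ar.
        apply: (le_trans (mle _ _ Ar)); case: (svalP r) => -[rD _] _.
        by apply: (le_trans (rD _ _)); rewrite addrC lerD.
      apply: (le_trans (mle _ _ Aq)); case: (svalP q) => -[qD _] _.
      by apply: (le_trans (qD _ _)); rewrite addrC lerD.
    have [->|an0] := eqVneq a 0.
      rewrite scale0r mul0r; apply: (le_trans (mle _ _ Aq0)).
      by case: (svalP q0) => /sublinear0 ->.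
    have a_gt0 : 0 < a by rewrite lt_def an0.
    rewrite -ler_pdivrMl//; apply: (mge) => q Aq; rewrite ler_pdivrMl//.
    apply: (le_trans (mle _ _ Aq)); case: (svalP q) => -[_ qZ] _.
    exact: qZ.
  have mp x : m x <= p x.
    apply: (le_trans (mle _ _ Aq0)); case: (svalP q0) => _; exact.
  exists (exist _ m (conj sm mp)) => s As.
  by apply/asboolP => x /=; exact: mle.
- case: (svalP q) => sq qp.
  have [q' sq' q'q|L LE] := minimal_sublinear_linear sq.
    have q'p x : q' x <= p x by apply: le_trans (qp x).
    have := qmax (exist _ q' (conj sq' q'p)).
    by move=> /(_ (asboolT q'q))/asboolP.
  by exists L => x; rewrite LE.
Qed.

(** The hypothesis is the inequality t <= p c on the convex cone of pairs (c, t)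
    generated by the pairs (y i, b i); lower p along this cone and take a linear
    functional below the result. *)
Lemma mazur_orlicz (I : Type) (p : E -> R) (y : I -> E) (b : I -> R) :
  sublinear p ->
  (forall r : seq (R * I), all (fun e => 0 <= e.1) r ->
     \sum_(e <- r) e.1 * b e.2 <= p (\sum_(e <- r) e.1 *: y e.2)) ->
  exists L : {scalar E}, (forall x, L x <= p x) /\ (forall i, b i <= L (y i)).
Proof.
move=> sp bp.
pose K c t := exists r : seq (R * I), [/\ all (fun e => 0 <= e.1) r,
   c = \sum_(e <- r) e.1 *: y e.2 & t = \sum_(e <- r) e.1 * b e.2].
have K0 : K 0 0 by exists [::]; split=> //; rewrite big_nil.
have KD c t d s : K c t -> K d s -> K (c + d) (t + s).
  move=> [r [r0 -> ->]] [r' [r'0 -> ->]]; exists (r ++ r').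
  by rewrite !big_cat all_cat r0 r'0.
have KZ a c t : 0 <= a -> K c t -> K (a *: c) (a * t).
  move=> a0 [r [r0 -> ->]]; exists [seq (a * e.1, e.2) | e <- r].
  split.
  - by rewrite all_map; apply: sub_all r0 => e /=; exact: mulr_ge0.
  - by rewrite big_map scaler_sumr; apply: eq_bigr => e _; rewrite scalerA.
  - by rewrite big_map mulr_sumr; apply: eq_bigr => e _; rewrite mulrA.
have Kp c t : K c t -> t <= p c by move=> [r [r0 -> ->]]; exact: bp.
have [L Lp] := hahn_banach (cone_lower_sublinear sp K0 KD KZ Kp).
exists L; split=> [x|i].
  apply: (le_trans (Lp x)).
  by have := cone_lower_le sp Kp x K0; rewrite addr0 subr0.
have Ki : K (y i) (b i).
  exists [:: (1, i)]; rewrite !big_seq1 scale1r mul1r; split=> //=.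
  by rewrite ler01.
have := le_trans (Lp (- y i)) (cone_lower_le sp Kp (- y i) Ki).
by rewrite addNr (sublinear0 sp) linearN sub0r lerN2.
Qed.

End MazurOrlicz.

(** * Summable functions on a discrete set *)

Section Ell1.
Variables (T : choiceType) (R : realType).

(** Summability is expressed by bounded partial sums: only comparisons with finite
    sums are used below. *)
Definition ell1_pred : {pred (T -> R)} := [pred f : T -> R |
  `[< exists M : R, forall D, uniq D -> \sum_(t <- D) `|f t| <= M >]].

Lemma ell1_pred_submod : submod_closed ell1_pred.
Proof.
split.
  by apply/asboolP; exists 0 => D _; rewrite big1// => t _; rewrite normr0.
move=> a f g /asboolP[M fM] /asboolP[N gN]; apply/asboolP.
exists (`|a| * M + N) => D uD.
apply: (@le_trans _ _ (\sum_(t <- D) (`|a| * `|f t| + `|g t|))).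
  by apply: ler_sum => t _; rewrite (le_trans (ler_normD _ _))// normrM.
by rewrite big_split -mulr_sumr lerD ?gN// ler_wpM2l ?fM.
Qed.

HB.instance Definition _ :=
  GRing.isSubmodClosed.Build R (T -> R) ell1_pred ell1_pred_submod.

Record ell1 := Ell1 { ell1_val :> T -> R; _ : ell1_val \in ell1_pred }.

HB.instance Definition _ := [isSub for ell1_val].
HB.instance Definition _ := [Choice of ell1 by <:].
HB.instance Definition _ := [SubChoice_isSubLmodule of ell1 by <:].

Implicit Types f g : ell1.

Definition norm1 f : R :=
  sup [set \sum_(t <- D) `|f t| | D in [set D : seq T | uniq D]].

Lemma sum_le_norm1 f D : uniq D -> \sum_(t <- D) `|f t| <= norm1 f.
Proof.
move=> uD; have /asboolP[M fM] := valP f.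
by apply: ub_le_sup; [exists M => _ [D' uD' <-]; exact: fM | exists D].
Qed.

Lemma norm1_le f M :
  (forall D, uniq D -> \sum_(t <- D) `|f t| <= M) -> norm1 f <= M.
Proof.
move=> fM; apply: ge_sup; last by move=> _ [D uD <-]; exact: fM.
by exists (\sum_(t <- [::]) `|f t|), [::].
Qed.

Lemma norm1_sublinear : sublinear norm1.
Proof.
split=> [f g|a f a0]; apply: norm1_le => D uD.
  apply: le_trans (lerD (sum_le_norm1 f uD) (sum_le_norm1 g uD)).
  by rewrite -big_split; apply: ler_sum => t _; exact: ler_normD.
apply: le_trans (ler_wpM2l a0 (sum_le_norm1 f uD)).
rewrite mulr_sumr; apply: ler_sum => t _.
by rewrite normrM (ger0_norm a0).
Qed.

Lemma ell1_sumE I (r : seq I) (F : I -> ell1) t :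
  (\sum_(i <- r) F i) t = \sum_(i <- r) F i t.
Proof. exact: (big_morph (fun f : ell1 => f t)). Qed.

Lemma sum_delta_le1 (u : T) D :
  uniq D -> \sum_(t <- D) `|(t == u)%:R| <= 1 :> R.
Proof.
move=> uD; have [uin|unin] := boolP (u \in D).
  rewrite (bigD1_seq u)//= eqxx normr1 big1 ?addr0// => t /negPf ->.
  exact: normr0.
rewrite big_seq big1 ?ler01// => t tD.
by rewrite (negPf (memPn unin t tD)) normr0.
Qed.

Lemma delta1_subproof (u : T) : (fun t => (t == u)%:R) \in ell1_pred.
Proof. by apply/asboolP; exists 1; exact: sum_delta_le1. Qed.

Definition delta1 u : ell1 := Ell1 (delta1_subproof u).

Lemma deltaBE u v t : (delta1 u - delta1 v) t = (t == u)%:R - (t == v)%:R.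
Proof. by []. Qed.

Lemma norm1_delta_le1 u : norm1 (delta1 u) <= 1.
Proof. by apply: norm1_le; exact: sum_delta_le1. Qed.

(** Half of the duality between l1 and bounded functions: a functional dominated
    by the norm is given by coefficients of modulus at most 1. *)
Lemma le_norm1_delta (L : {scalar ell1}) u :
  (forall f, L f <= norm1 f) -> `|L (delta1 u)| <= 1.
Proof.
move=> Ln; rewrite ler_norml (le_trans (Ln _) (norm1_delta_le1 u)) andbT.
rewrite lerNl -linearN; apply: (le_trans (Ln _)).
apply: norm1_le => D /(sum_delta_le1 u); congr (_ <= _).
by apply: eq_bigr => t _; rewrite normrN.
Qed.

End Ell1.


(** * Invariant means and almost invariant functions *)

Lemma norm_realC (R : rcfType) (a : R) : `|a%:C%C| = `|a|%:C%C.
Proof. by rewrite normc_def/= expr0n addr0 sqrtr_sqr. Qed.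

Section States.
Variables (G : groupType) (R : realType).

Lemma linf_sumE I (r : seq I) (F : I -> linf G R) x :
  (\sum_(i <- r) F i) x = \sum_(i <- r) F i x.
Proof. exact: (big_morph (fun f : linf G R => f x)). Qed.

Lemma state_le (phi : {scalar linf G R}) (f g : linf G R) : is_state phi ->
  (forall x, f x <= g x) -> phi f <= phi g.
Proof.
move=> [phi_ge0 _] fg; rewrite -subr_ge0 -linearB; apply: phi_ge0 => x.
by have := fg x; rewrite -subr_ge0.
Qed.

Lemma real_linf_subproof (f : G -> R) (M : R) :
  (forall x, `|f x| <= M) -> (fun x => (f x)%:C%C) \in @bounded_pred G R.
Proof.
move=> fM; apply/asboolP; exists M => x.
by rewrite norm_realC lecR.
Qed.

Definition real_linf (f : G -> R) (M : R) (fM : forall x, `|f x| <= M) :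
  linf G R := Linf (real_linf_subproof fM).

End States.

Section Reiter.
Variables (R : realType) (G : groupType).
Hypothesis amG : amenable G R.

(** For f = sum_i a_i delta_(g_i), the combination sum_i a_i (shift_defect S g_i)
    is the family, indexed by s in S, of the differences between the left
    translate of f by s and f.  All of them are packed in one element of
    l1(G x G), so that a single functional separates them from 0. *)
Definition shift_defect (S : seq G) (g : G) : ell1 (G * G)%type R :=
  \sum_(s <- S) (delta1 R (s, (s * g)%g) - delta1 R (s, g)).

Lemma shift_defectE S g s h : uniq S -> s \in S ->
  shift_defect S g (s, h) = (h == s * g)%g%:R - (h == g)%:R.
Proof.
move=> uS sS; rewrite /shift_defect ell1_sumE (bigD1_seq s sS uS) big1.
  by rewrite deltaBE !xpair_eqE eqxx /= addr0.
by move=> t ts; rewrite deltaBE !xpair_eqE eq_sym (negPf ts) subrr.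
Qed.

(** If the inequality failed for all weights, a functional L dominated by the norm
    would satisfy L (shift_defect S g) >= e for every g.  Its coefficients F s
    being bounded, the mean of g |-> sum_s (F s (s g) - F s g) would be at least
    e, whereas it is 0 by invariance. *)
Lemma amenable_shift_defect (S : seq G) (e : R) : 0 < e ->
  exists r : seq (R * G), all (fun w => 0 <= w.1) r /\
    norm1 (\sum_(w <- r) w.1 *: shift_defect S w.2) < \sum_(w <- r) w.1 * e.
Proof.
move=> e0; apply: contrapT => nr.
have [|L [Ln Le]] := @mazur_orlicz R _ G _ (shift_defect S) (fun=> e)
  (norm1_sublinear _ _).
  by move=> r r0; rewrite leNgt; apply/negP => rlt; apply: nr; exists r.
pose F s x := L (delta1 R (s, x)).
have F1 s x : `|F s x| <= 1 by exact: le_norm1_delta.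
have [phi [phiS phiT]] := amG.
pose f s := real_linf (F1 s).
suff : phi (linf_cst G e%:C%C) <= 0.
  have -> : linf_cst G e%:C%C = e%:C%C *: linf_cst G 1.
    by apply/val_inj/funext => x /=; rewrite [RHS]mulr1.
  by rewrite linearZ/= phiS.2 mulr1 lecR leNgt e0.
have -> : 0 = phi (\sum_(s <- S) (ltranslate s^-1%g (f s) - f s)).
  by rewrite linear_sum big1// => s _; rewrite linearB/= phiT subrr.
apply: state_le => // x; rewrite linf_sumE.
apply: (@le_trans _ _ (L (shift_defect S x))%:C%C); first by rewrite lecR.
rewrite linear_sum rmorph_sum; rewrite le_eqVlt; apply/orP; left; apply/eqP.
by apply: eq_bigr => s _; rewrite linearB rmorphB/= invgK.
Qed.

(** Reiter's condition.  The finite set D contains the supports of f and of its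
    translates by S, so that sums over D are sums over G. *)
Lemma reiter (S : seq G) (e : R) : 0 < e ->
  exists (D : seq G) (f : G -> R),
    [/\ uniq D, forall h, 0 <= f h,
        0 < \sum_(h <- D) f h,
        forall h, h \notin D -> f h = 0 /\ forall s, s \in S -> f (s^-1 * h)%g = 0 &
        forall s, s \in S ->
          \sum_(h <- D) `|f (s^-1 * h)%g - f h| <= e * \sum_(h <- D) f h].
Proof.
move=> e0; have [r [r0 rlt]] := amenable_shift_defect (undup S) e0.
pose f h : R := \sum_(w <- r) w.1 * (h == w.2)%:R.
pose D := undup ([seq w.2 | w <- r] ++ [seq (s * w.2)%g | s <- S, w <- r]).
have uD : uniq D by exact: undup_uniq.
have fD h : (forall w, w \in r -> h != w.2) -> f h = 0.
  move=> hr; rewrite /f big_seq big1// => w wr.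
  by rewrite (negPf (hr _ wr)) mulr0.
have sumf : \sum_(h <- D) f h = \sum_(w <- r) w.1.
  rewrite exchange_big/=; apply: eq_big_seq => w wr.
  have wD : w.2 \in D by rewrite mem_undup mem_cat map_f.
  rewrite (bigD1_seq w.2)//= eqxx mulr1 big1 ?addr0// => h /negPf ->.
  by rewrite mulr0.
have defE s h : s \in S ->
    (\sum_(w <- r) w.1 *: shift_defect (undup S) w.2) (s, h) =
    f (s^-1 * h)%g - f h.
  move=> sS; rewrite ell1_sumE -sumrB; apply: eq_bigr => w _.
  rewrite -mulrBr -[LHS]/(w.1 * shift_defect (undup S) w.2 (s, h)).
  rewrite shift_defectE ?undup_uniq ?mem_undup//.
  by rewrite -(can_eq (mulKg s) (s^-1 * h)%g) mulVKg.
exists D, f; split=> //.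
- move=> h; rewrite /f big_seq sumr_ge0// => w wr.
  by rewrite mulr_ge0// (allP r0).
- rewrite sumf -(pmulr_lgt0 _ e0) mulr_suml.
  apply: le_lt_trans rlt; apply: le_trans (sum_le_norm1 _ (D := [::]) _) => //.
  by rewrite big_nil.
- move=> h; rewrite mem_undup mem_cat negb_or => /andP[h1 h2]; split.
    by apply: fD => w wr; apply: contra h1 => /eqP ->; exact: map_f.
  move=> s sS; apply: fD => w wr; apply: contra h2 => /eqP sh.
  by apply/allpairsP; exists (s, w); rewrite /= -sh mulVKg.
- move=> s sS; have uD' : uniq [seq (s, h) | h <- D].
    by rewrite map_inj_uniq// => h h' [].
  rewrite sumf mulrC mulr_suml; apply: ltW; apply: le_lt_trans rlt.
  apply: le_trans (sum_le_norm1 _ uD'); rewrite big_map.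
  by apply: ler_sum => h _; rewrite defE.
Qed.

Lemma sqr_sqrtB_le (a b : R) : 0 <= a -> 0 <= b ->
  (Num.sqrt a - Num.sqrt b) ^+ 2 <= `|a - b|.
Proof.
move=> a0 b0; rewrite -[in leRHS](sqr_sqrtr a0) -[in leRHS](sqr_sqrtr b0).
rewrite subr_sqr normrM -real_normK ?num_real// expr2 ler_wpM2l//.
by rewrite ler_norml !ger0_norm ?addr_ge0 ?sqrtr_ge0//;
  have := sqrtr_ge0 a; have := sqrtr_ge0 b; lra.
Qed.

(** The square roots of the functions of Reiter's condition: the elementary bound
    [sqr_sqrtB_le] turns l1-invariance of f into l2-invariance of c. *)
Lemma amenable_l2_almost_invariant (S : seq G) (e : R) : 0 < e ->
  exists (D : seq G) (c : G -> R),
    [/\ uniq D, 0 < \sum_(h <- D) c h ^+ 2,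
        forall h, h \notin D -> c h = 0,
        forall s h, s \in S -> h \notin D -> c (s^-1 * h)%g = 0 &
        forall s, s \in S ->
          \sum_(h <- D) (c (s^-1 * h)%g - c h) ^+ 2 <=
          e * \sum_(h <- D) c h ^+ 2].
Proof.
move=> /(reiter S)[D [f [uD f0 sumf fD fS]]].
exists D, (fun h => Num.sqrt (f h)).
have cf : \sum_(h <- D) Num.sqrt (f h) ^+ 2 = \sum_(h <- D) f h.
  by apply: eq_bigr => h _; rewrite sqr_sqrtr.
rewrite cf; split=> //.
- by move=> h /fD[-> _]; rewrite sqrtr0.
- by move=> s h sS /fD[_ ->//]; rewrite sqrtr0.
- move=> s /fS; apply: le_trans; apply: ler_sum => h _.
  exact: sqr_sqrtB_le.
Qed.

End Reiter.

(** * Conjugation in ICC groups *)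

Section Conjugates.
Variables (R : realType) (G : groupType).

Lemma norm_indicator_le1 (A : pred G) x : `|(A x)%:R : R| <= 1.
Proof. by case: (A x); rewrite ?normr1 ?normr0. Qed.

Definition indicator (A : pred G) : linf G R := real_linf (norm_indicator_le1 A).

Lemma indicatorE A x : indicator A x = (A x)%:R.
Proof. by rewrite /= rmorph_nat. Qed.

(** The set B of the x with x^-1 g x = k has pairwise disjoint translates y B, one
    for each conjugate z = y g y^-1 of g: a point x lies in y B exactly when
    z = x k x^-1.  Hence n times its mean is at most 1 for all n. *)
Lemma conj_indicator_null (phi : {scalar linf G R}) (g k : G) :
  is_state phi -> (forall s f, phi (ltranslate s f) = phi f) ->
  infinite_set [set (x * g * x^-1)%g | x in [set: G]] ->
  phi (indicator (fun x => x^-1 * g * x == k)%g) <= 0.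
Proof.
move=> phiS phiT ginf; set a := phi _.
have an n : a *+ n <= 1.
  have [B Bsub Bn] := infinite_set_fset n ginf.
  (* y z is some element conjugating g to z; it indexes the translates of B *)
  have /choice[y yP] : forall z : G, exists y, z \in B -> z = (y * g * y^-1)%g.
    move=> z; have [zB|_] := boolP (z \in B); last by exists 1%g.
    by have [y _ <-] := Bsub z zB; exists y.
  pose Z := take n (finmap.enum_fset B).
  have Zn : size Z = n by rewrite size_take_min; apply/minn_idPl.
  have ZB z : z \in Z -> z \in B by exact: mem_take.
  have uZ : uniq Z by rewrite take_uniq// finmap.fset_uniq.
  rewrite -Zn -sum1_size -sumrMnr.
  have -> : \sum_(z <- Z) a *+ 1 = phi (\sum_(z <- Z)
      ltranslate (y z) (indicator (fun x => x^-1 * g * x == k)%g)).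
    by rewrite linear_sum; apply: eq_bigr => z _; rewrite phiT.
  rewrite -phiS.2; apply: state_le => // x; rewrite linf_sumE.
  rewrite (eq_big_seq (fun z => ((z == x * k * x^-1)%g%:R : R)%:C%C)).
    rewrite -rmorph_sum lecR.
    apply: le_trans (sum_delta_le1 R (x * k * x^-1)%g uZ).
    by apply: ler_sum => z _; exact: ler_norm.
  move=> z /ZB/yP zE; rewrite /= !rmorph_nat; congr (nat_of_bool _)%:R.
  rewrite [in RHS]zE invgM invgK -[in LHS](inj_eq (mulgI x)).
  rewrite -[in LHS](inj_eq (mulIg x^-1%g)).
  by rewrite !mulgA mulgV mul1g mulgK.
have a0 : 0 <= a by apply: phiS.1 => x; rewrite indicatorE ler0n.
case: a an a0 => a b an; rewrite lecE/= => /andP[/eqP b0 a0].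
move: an; rewrite {}b0 => an; rewrite lecE/= eqxx/= leNgt; apply/negP => a_gt0.
have {}an n : a *+ n <= 1.
  have : a%:C%C *+ n <= 1 := an n.
  by rewrite -rmorphMn lecR.
have := an (Num.bound a^-1); rewrite -mulr_natr leNgt => /negP; apply.
rewrite mulrC -ltr_pdivrMr// div1r.
by have := archi_boundP (ltW (eqbRL (invr_gt0 a) a_gt0)).
Qed.

(** The x excluded by a pair (g, k) in F x K have mean zero, so finitely many such
    pairs cannot exclude all of G. *)
Lemma icc_conjugate_escape (F K : seq G) : amenable G R -> icc G ->
  (forall g, g \in F -> g != 1%g) ->
  exists x, forall g, g \in F -> (x^-1 * g * x)%g \notin K.
Proof.
move=> [phi [phiS phiT]] iccG F1; apply: contrapT => nx.
pose I g k := indicator (fun x => x^-1 * g * x == k)%g.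
have : phi (linf_cst G 1) <= phi (\sum_(g <- F) \sum_(k <- K) I g k).
  apply: state_le => // x; rewrite linf_sumE.
  have [g gF gK] : exists2 g, g \in F & (x^-1 * g * x)%g \in K.
    apply: contrapT => ng; apply: nx; exists x => g gF; apply/negP => gK.
    by apply: ng; exists g.
  have I0 g' k : 0 <= I g' k x by rewrite indicatorE ler0n.
  have J0 g' : 0 <= (\sum_(k <- K) I g' k) x.
    by rewrite linf_sumE sumr_ge0.
  rewrite (big_rem g gF); apply: le_trans (_ : (\sum_(k <- K) I g k) x <= _).
    rewrite linf_sumE (big_rem _ gK) /= rmorph_nat eqxx lerDl.
    by apply: sumr_ge0 => k _; exact: I0.
  by rewrite lerDl; exact: sumr_ge0.
rewrite phiS.2 => /le_trans h; have : (1 : R[i]%C) <= 0; last by rewrite ler10.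
apply: h; rewrite linear_sum big_seq sumr_le0// => g gF.
rewrite linear_sum sumr_le0// => k _.
exact: conj_indicator_null (iccG g (F1 g gF)).
Qed.

End Conjugates.

(** * Orbits satisfying a Bessel inequality *)

Lemma sum_le_esum (T : choiceType) (R : realType) (D : seq T) (f : T -> R) :
  uniq D -> (forall t, 0 <= f t) ->
  ((\sum_(t <- D) f t)%:E <= \esum_(t in [set: T]) (f t)%:E)%E.
Proof.
move=> uD f0; rewrite -sumEFin.
apply: ereal_sup_ubound => /=; exists [set` D]; last first.
  by rewrite -fsbig_seq.
by split => //; exact: finite_seq.
Qed.

Lemma esum_level_finite (T : choiceType) (R : realType) (f : T -> R) (d : R) :
  (forall t, 0 <= f t) -> 0 < d ->
  (\esum_(t in [set: T]) (f t)%:E < +oo)%E -> finite_set [set t | d <= f t].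
Proof.
move=> f0 d0 foo; apply: contrapT => dinf.
have : (\esum_(t in [set: T]) (f t)%:E)%E \is a fin_num.
  by rewrite ge0_fin_numE// esum_ge0// => t _; rewrite lee_fin.
move=> /fineK; set M := fine _ => ME.
have [B Bsub Bn] := infinite_set_fset (Num.bound (M / d)) dinf.
have M0 : 0 <= M by rewrite -lee_fin ME esum_ge0// => t _; rewrite lee_fin.
have := sum_le_esum (finmap.fset_uniq B) f0; rewrite -ME lee_fin leNgt.
move=> /negP; apply.
have Md : M < (Num.bound (M / d))%:R * d.
  by rewrite -ltr_pdivrMr//; apply: archi_boundP; rewrite divr_ge0// ltW.
apply: (lt_le_trans Md).
apply: (@le_trans _ _ (\sum_(t <- finmap.enum_fset B) d)).
  by rewrite big_const_seq count_predT iter_addr_0 -[leRHS]mulr_natl ler_wpM2r ?ler_nat// ltW.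
by rewrite big_seq [leRHS]big_seq; apply: ler_sum => t tB; exact: Bsub.
Qed.

Lemma rnormE (R : realType) (V : normedZmodType R[i]%C) (v : V) :
  `|v| = (rnorm v)%:C%C.
Proof.
rewrite /rnorm; have := normr_ge0 v; case: `|v| => a b.
by rewrite lecE/= => /andP[/eqP -> _].
Qed.

Lemma rnorm_ge0 (R : realType) (V : normedZmodType R[i]%C) (v : V) :
  0 <= rnorm v.
Proof. by have := normr_ge0 v; rewrite rnormE lecR. Qed.

Section Orbit.
Variables (R : realType) (G : groupType) (H : hilbertSpace R).
Variables (pi : unitary_rep G H).

Lemma inner_rep g h (u v : H) :
  inner H (pi g u) (pi h v) = inner H u (pi (g^-1 * h)%g v).
Proof.
have [_ pig] := rep_unitary pi g.
by rewrite -[in LHS](mulVKg g h) repM pig.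
Qed.

Lemma inner_self (v : H) : inner H v v = (rnorm v ^+ 2)%:C%C.
Proof. by rewrite inner_norm rnormE rmorphXn. Qed.

Lemma rnorm_rep g v : rnorm (pi g v) = rnorm v.
Proof.
have [_ pig] := rep_unitary pi g; have := pig v v.
rewrite !inner_self => -[] /eqP.
by rewrite eqrXn2 ?rnorm_ge0// => /eqP.
Qed.

Variables (phi : H) (b : R).
Hypothesis bessel : forall v : H,
  (\esum_(g in [set: G]) (rnorm (inner H v (pi g phi)) ^+ 2)%:E <=
     (b * rnorm v ^+ 2)%:E)%E.
Hypotheses (amG : amenable G R) (iccG : icc G).

(** The inner product is psi (x^-1 (h^-1 k) x) with psi g = <phi, pi_g phi>; the
    set where |psi| >= eta is finite by the Bessel inequality at phi, and x moves
    the finitely many h^-1 k away from it. *)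
Lemma translate_almost_orthogonal (D : seq G) (eta : R) : 0 < eta ->
  exists x, forall h k, h \in D -> k \in D -> h != k ->
    rnorm (inner H (pi (h * x)%g phi) (pi (k * x)%g phi)) <= eta.
Proof.
move=> eta0.
have : finite_set [set g | eta ^+ 2 <= rnorm (inner H phi (pi g phi)) ^+ 2].
  apply: esum_level_finite; first by move=> t; exact: sqr_ge0.
    by rewrite exprn_gt0.
  by apply: le_lt_trans (bessel phi) _; exact: ltry.
move=> /finite_seqP[K KE].
pose F := [seq w <- [seq (h^-1 * k)%g | h <- D, k <- D] | w != 1%g].
have [g|x xP] := icc_conjugate_escape (F := F) K amG iccG.
  by rewrite mem_filter => /andP[].
exists x => h k hD kD hk; rewrite inner_rep.
have : (h^-1 * k)%g \in F.
  rewrite mem_filter; apply/andP; split.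
    by apply: contra hk => /eqP/mulg1_eq; rewrite invgK => ->.
  by apply/allpairsP; exists (h, k).
move=> /xP; rewrite invgM !mulgA; set g := (_ * _)%g => gK.
rewrite leNgt; apply/negP => etag; move/negP: gK; apply.
suff : [set` K] g by [].
by rewrite -KE /= ler_sqr ?nnegrE ?rnorm_ge0 ?ltW.
Qed.

(** The element x depends on D and eta but not on d: below it has to serve
    simultaneously for c and for the differences between c and its translates. *)
Lemma translate_norm_sqr (D : seq G) (eta : R) : uniq D -> 0 < eta ->
  exists x, forall d : G -> R,
    `|rnorm (\sum_(h <- D) (d h)%:C%C *: pi (h * x)%g phi) ^+ 2
      - rnorm phi ^+ 2 * \sum_(h <- D) d h ^+ 2|
    <= eta * (\sum_(h <- D) `|d h|) ^+ 2.
Proof.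
move=> uD eta0; have [x xP] := translate_almost_orthogonal D eta0.
exists x => d.
set u := fun h => pi (h * x)%g phi.
have uu h : inner H (u h) (u h) = (rnorm phi ^+ 2)%:C%C.
  by rewrite inner_self rnorm_rep.
set w := \sum_(h <- D) _.
have wE : inner H w w =
    \sum_(h <- D) \sum_(k <- D) (d h * d k)%:C%C * inner H (u h) (u k).
  rewrite linear_sumlz; apply: eq_bigr => h _.
  rewrite linear_sumr; apply: eq_bigr => k _.
  rewrite linearZl_LR linearZr_LR/=.
  by rewrite conj_Creal ?mulrA ?rmorphM//; apply/complex_realP; exists (d k).
have phiE : (rnorm phi ^+ 2 * \sum_(h <- D) d h ^+ 2)%:C%C =
    \sum_(h <- D) \sum_(k <- D)
      (d h * d k)%:C%C * ((h == k)%:R * (rnorm phi ^+ 2)%:C%C).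
  rewrite mulr_sumr rmorph_sum; apply: eq_big_seq => h hD.
  rewrite (bigD1_seq h)//= eqxx mul1r big1 ?addr0; last first.
    by move=> k; rewrite eq_sym => /negPf ->; rewrite mul0r mulr0.
  by rewrite -rmorphM/= mulrC expr2.
rewrite -lecR -norm_realC.
have -> : (rnorm w ^+ 2 - rnorm phi ^+ 2 * \sum_(h <- D) d h ^+ 2)%:C%C =
    inner H w w - (rnorm phi ^+ 2 * \sum_(h <- D) d h ^+ 2)%:C%C.
  by rewrite inner_self; exact: rmorphB.
rewrite wE phiE.
rewrite -sumrB; apply: le_trans (ler_norm_sum _ _ _) _.
rewrite [in leRHS]expr2 mulr_suml mulr_sumr rmorph_sum/=.
rewrite big_seq [leRHS]big_seq; apply: ler_sum => h hD.
rewrite -sumrB; apply: le_trans (ler_norm_sum _ _ _) _.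
rewrite !mulr_sumr rmorph_sum/=.
rewrite big_seq [leRHS]big_seq; apply: ler_sum => k kD.
rewrite -mulrBr normrM norm_realC normrM mulrC [in leRHS]rmorphM/=.
apply: ler_pM => //; first by rewrite lecR mulr_ge0.
have [<-|hk] := eqVneq h k.
  by rewrite uu mul1r subrr normr0 lecR ltW.
by rewrite mul0r subr0 rnormE lecR; exact: xP.
Qed.

End Orbit.

(** * Almost invariant vectors *)

Lemma eq_big_uniq_support (T : eqType) (V : nmodType) (D D' : seq T) (F : T -> V) :
  uniq D -> uniq D' -> (forall t, F t != 0 -> (t \in D) && (t \in D')) ->
  \sum_(t <- D) F t = \sum_(t <- D') F t.
Proof.
move=> uD uD' FD.
have supp (A : seq T) : \sum_(t <- A) F t = \sum_(t <- [seq t <- A | F t != 0]) F t.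
  rewrite big_filter [LHS](bigID (fun t => F t == 0))/= big1 ?add0r//.
  by move=> t /eqP.
rewrite supp [RHS]supp; apply/perm_big/uniq_perm; rewrite ?filter_uniq// => t.
rewrite !mem_filter; have [//|/FD/andP[-> ->]//] := eqVneq (F t) 0.
Qed.

Lemma sum_left_translate (G : groupType) (K : pzRingType) (V : lmodType K)
    (D : seq G) (s : G) (c : G -> K) (u : G -> V) : uniq D ->
  (forall h, h \notin D -> c h = 0) ->
  (forall h, h \notin D -> c (s^-1 * h)%g = 0) ->
  \sum_(h <- D) c h *: u (s * h)%g = \sum_(h <- D) c (s^-1 * h)%g *: u h.
Proof.
move=> uD cD csD.
transitivity (\sum_(h <- [seq (s * h)%g | h <- D]) c (s^-1 * h)%g *: u h).
  by rewrite big_map; apply: eq_bigr => h _; rewrite mulKg.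
apply: eq_big_uniq_support => //; first by rewrite map_inj_uniq//; exact: mulgI.
move=> h cu0; have c0 : c (s^-1 * h)%g != 0.
  by apply: contraNneq cu0 => ->; rewrite scale0r.
apply/andP; split; last by apply: contraNT c0 => /csD ->.
apply/mapP; exists (s^-1 * h)%g; last by rewrite mulVKg.
by apply: contraNT c0 => /cD ->.
Qed.

Lemma rnormZ (R : realType) (H : hilbertSpace R) (a : R) (v : H) :
  rnorm (a%:C%C *: v) = `|a| * rnorm v.
Proof.
apply: complexI; rewrite -rnormE normrZ norm_realC rnormE.
by rewrite -rmorphM.
Qed.

Section AlmostInvariant.
Variables (R : realType) (G : groupType) (H : hilbertSpace R).
Variables (pi : unitary_rep G H).
Variables (phi : H) (b : R).
Hypothesis bessel : forall v : H,
  (\esum_(g in [set: G]) (rnorm (inner H v (pi g phi)) ^+ 2)%:E <=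
     (b * rnorm v ^+ 2)%:E)%E.
Hypotheses (amG : amenable G R) (iccG : icc G) (phi0 : phi != 0).

(** The vector is w_x = sum_h c(h) pi_(hx) phi, normalized, for c almost invariant
    in l2 and x given by [translate_norm_sqr]. *)
Lemma bessel_orbit_almost_invariant (S : seq G) (e : R) : 0 < e ->
  exists v : H, rnorm v = 1 /\ forall s, s \in S -> rnorm (pi s v - v) <= e.
Proof.
move=> e0; pose eps := Num.min (e ^+ 2 / 4) (2^-1).
have eps0 : 0 < eps by rewrite lt_min divr_gt0 ?exprn_gt0//= invr_gt0.
have eps1 : eps <= 2^-1 by rewrite ge_min lexx orbT.
have eps2 : eps <= e ^+ 2 / 4 by rewrite ge_min lexx.
have [D [c [uD]]] := amenable_l2_almost_invariant amG S eps0.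
set C := \sum_(h <- D) c h ^+ 2 => C0 cD csD cS.
pose d s h := c (s^-1 * h)%g - c h.
pose M := rnorm phi ^+ 2.
have M0 : 0 < M.
  rewrite exprn_gt0// lt_def rnorm_ge0 andbT; apply: contra phi0 => /eqP p0.
  by rewrite -normr_eq0 rnormE p0.
(* Q bounds all the squared l1-norms that multiply eta in the error terms, which
   are therefore at most |phi|^2 |c|^2 eps. *)
pose Q := (\sum_(h <- D) `|c h|) ^+ 2 +
  \sum_(s <- S) (\sum_(h <- D) `|d s h|) ^+ 2 + 1.
have sum0 : 0 <= \sum_(s <- S) (\sum_(h <- D) `|d s h|) ^+ 2.
  by apply: sumr_ge0 => s _; exact: sqr_ge0.
have Q0 : 0 < Q by rewrite ltr_wpDl ?ltr01// addr_ge0 ?sqr_ge0.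
have MC0 : 0 < M * C by exact: mulr_gt0.
have MCe0 : 0 < M * C * eps by exact: mulr_gt0.
pose eta := M * C * eps / Q.
have eta0 : 0 < eta by exact: divr_gt0.
have etaQ q : q <= Q -> eta * q <= M * C * eps.
  move=> qQ; rewrite /eta mulrAC ler_pdivrMr// ler_wpM2l//.
  exact: ltW.
have [x xP] := translate_norm_sqr bessel amG iccG uD eta0.
pose u h := pi (h * x)%g phi.
pose w := \sum_(h <- D) (c h)%:C%C *: u h.
have w_ge : M * C / 2 <= rnorm w ^+ 2.
  have := xP c; rewrite -/u -/w -/M -/C ler_norml => /andP[+ _].
  have := etaQ ((\sum_(h <- D) `|c h|) ^+ 2).
  rewrite /Q -addrA lerDl addr_ge0// => /(_ isT).
  have : M * C * eps <= M * C * 2^-1 by rewrite ler_wpM2l// ltW.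
  by lra.
have w0 : 0 < rnorm w.
  rewrite lt_def rnorm_ge0 andbT; apply/eqP => rw0; move: w_ge.
  by rewrite rw0 expr0n leNgt divr_gt0.
have pis s : s \in S -> pi s w - w = \sum_(h <- D) (d s h)%:C%C *: u h.
  move=> sS; have -> : pi s w = \sum_(h <- D) (c (s^-1 * h)%g)%:C%C *: u h.
    rewrite -(@sum_left_translate _ _ _ D s (fun h => (c h)%:C%C))//; last 2 first.
    - by move=> h /cD ->.
    - by move=> h /(csD _ _ sS) ->.
    rewrite linear_sum; apply: eq_bigr => h _.
    by rewrite linearZ/= /u -repM mulgA.
  rewrite -sumrB; apply: eq_bigr => h _.
  by rewrite -scalerBl -rmorphB.
have wV0 : 0 <= (rnorm w)^-1 by rewrite invr_ge0 ltW.
exists ((rnorm w)^-1%:C%C *: w); split.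
  by rewrite rnormZ ger0_norm// mulVf// gt_eqF.
move=> s sS; rewrite linearZ/= -scalerBr rnormZ ger0_norm//.
rewrite ler_pdivrMl// -ler_sqr ?nnegrE ?rnorm_ge0//; last first.
  by rewrite mulr_ge0// ltW.
rewrite exprMn pis//.
have := xP (d s); rewrite -/u -/M ler_norml => /andP[_ ].
have := etaQ ((\sum_(h <- D) `|d s h|) ^+ 2).
have -> : (\sum_(h <- D) `|d s h|) ^+ 2 <= Q.
  rewrite /Q (big_rem s sS)/=.
  have := sqr_ge0 (\sum_(h <- D) `|c h|).
  have : 0 <= \sum_(t <- rem s S) (\sum_(h <- D) `|d t h|) ^+ 2.
    by apply: sumr_ge0 => t _; exact: sqr_ge0.
  by lra.
move=> /(_ isT) dQ dM.
have dC : M * \sum_(h <- D) d s h ^+ 2 <= M * C * eps.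
  by rewrite -mulrA ler_wpM2l ?(ltW M0)// mulrC; exact: cS.
have MCe : M * C * eps <= M * C * (e ^+ 2 / 4) by rewrite ler_wpM2l// ltW.
have we : M * C / 2 * e ^+ 2 <= rnorm w ^+ 2 * e ^+ 2.
  by rewrite ler_wpM2r// sqr_ge0.
lra.
Qed.

End AlmostInvariant.

(** The net is indexed by pairs of a finite family of elements of G and a
    precision, so that going far in the net means testing invariance under more
    elements and with a smaller error. *)
Theorem theorem2p19 (R : realType) (G : groupType) :
  [set: G] #= [set: nat] -> amenable G R -> icc G ->
  forall H : hilbertSpace R, separable H -> (exists v : H, v != 0) ->
  forall pi : unitary_rep G H, frame_rep pi -> almost_invariant_vectors pi.
Proof.
move=> _ amG iccG H _ [v0 v0_neq0] pi [phi [a [b [a0 b0 frame]]]].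
have bessel v := (frame v).2.
have phi_neq0 : phi != 0.
  apply: contra v0_neq0 => /eqP phi0; have [+ _] := frame v0.
  rewrite esum1; last first.
    move=> g _; rewrite phi0 linear0 linear0r.
    by rewrite /rnorm normr0 expr0n.
  rewrite lee_fin pmulr_rle0// => v0_le0.
  rewrite -normr_eq0 rnormE; suff /eqP -> : rnorm v0 == 0 by [].
  by rewrite -sqrf_eq0 eq_le v0_le0 sqr_ge0.
have step (i : seq G * nat) : exists v : H, rnorm v = 1 /\
    forall s, s \in i.1 -> rnorm (pi s v - v) <= i.2.+1%:R^-1.
  by apply: bessel_orbit_almost_invariant bessel amG iccG phi_neq0 _ _ _; rewrite invr_gt0.
have [v vP] := choice step.
exists (seq G * nat)%type, (fun i j => {subset i.1 <= j.1} /\ (i.2 <= j.2)%N), v.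
split.
- split; first by constructor; exact: ([::], 0%N).
  + by move=> i; split.
  + move=> i j k [ij ij'] [jk jk']; split; last exact: leq_trans jk'.
    by move=> g /ij/jk.
  + move=> i j; exists (i.1 ++ j.1, maxn i.2 j.2).
    by split; split=> /=; rewrite ?leq_maxl ?leq_maxr// => g gi;
      rewrite mem_cat gi ?orbT.
- by move=> i; have [] := vP i.
- move=> g A /nbhs_ballP[r /= r0 rA].
  exists ([:: g], Num.bound r^-1) => j [gj nj]; apply: rA.
  rewrite /ball/= sub0r normrN ger0_norm ?rnorm_ge0//.
  have [_ /(_ g)] := vP j; rewrite gj ?mem_head// => /(_ isT) /le_lt_trans; apply.
  rewrite invf_plt ?posrE//; apply: lt_le_trans (archi_boundP _) _.
    by rewrite invr_ge0 ltW.
  by rewrite ler_nat ltnW.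
Qed.
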